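(* Let $f=b_0+\sum_{j=1}^n b_j\mathbf{x}^{\alpha(j)}+\sum_{i=1}^k a_i\mathbf{x}^{y(i)}\in\mathbb{R}[x_1,\dots,x_n]$ be nonnegative on $\mathbb{R}^n$, with $b_j\in\mathbb{R}_{>0}$ and $a_i\in\mathbb{R}\setminus\{0\}$, such that $\operatorname{New}(f)=\Delta=\operatorname{conv}\{0,\alpha(1),\dots,\alpha(n)\}$ is an ($n$-dimensional) simplex with all $\alpha(j)\in(2\mathbb{N})^n$ and all $y(i)\in\operatorname{int}(\Delta)\cap\mathbb{N}^n$. If there exists a vector $\mathbf{v}\in(\mathbb{R}\setminus\{0\})^n$ such that $a_i\mathbf{v}^{y(i)}<0$ for all $1\le i\le k$, then $f$ is SONC, i.e. $f$ is a sum of nonnegative circuit polynomials.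
   Context: $\mathbb{N}=\{0,1,2,\dots\}$; $\operatorname{New}(f)$ is the Newton polytope. For an even lattice simplex $\Delta'=\operatorname{conv}\{\beta(0),\dots,\beta(m)\}\subset\mathbb{R}^n$ (vertices $\beta(j)\in(2\mathbb{N})^n$, affinely independent, $0\le m\le n$) and a lattice point $y$ in the (relative) interior of $\Delta'$, $P_{\Delta'}^y$ is the set of (circuit) polynomials $\sum_{j=0}^m b_j\mathbf{x}^{\beta(j)}+c\,\mathbf{x}^y$ with all $b_j>0$ and $c\in\mathbb{R}\setminus\{0\}$; monomial squares $b\,\mathbf{x}^\beta$ ($b>0$, $\beta\in(2\mathbb{N})^n$) are regarded as circuit polynomials on the $0$-dimensional simplex $\{\beta\}$. $f$ is SONC if $f=\sum_{i}\mu_i g_i$ (finite sum) with $\mu_i\ge0$ and each $g_i\in P_{\Delta_i}^{y_i}$ nonnegative on $\mathbb{R}^n$ and of degree at most $2d$ (where $f$ has degree at most $2d$), for some even lattice simplices $\Delta_i$ and lattice points $y_i$ in their (relative) interiors. *)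

(* Defs.v *)
From HB Require Import structures.
From mathcomp Require Import all_boot all_order all_algebra.
From mathcomp Require Import boolp classical_sets reals topology.
From mathcomp Require Export mpoly.

Set Implicit Arguments.
Unset Strict Implicit.
Unset Printing Implicit Defensive.

Import Order.TTheory GRing.Theory Num.Theory.
Import numFieldTopology.Exports.

Local Open Scope classical_set_scope.
Local Open Scope ring_scope.

Section Geometry.
Context {R : realType} {n : nat}.
Implicit Types A : set 'rV[R]_n.

Definition convex_hull A : set 'rV[R]_n :=
  [set x | exists m (p : 'I_m -> 'rV[R]_n) (c : 'I_m -> R),
    [/\ forall i, A (p i), forall i, 0 <= c i, \sum_i c i = 1
      & x = \sum_i c i *: p i]].

Definition affine_hull A : set 'rV[R]_n :=
  [set x | exists m (p : 'I_m -> 'rV[R]_n) (c : 'I_m -> R),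
    [/\ forall i, A (p i), \sum_i c i = 1 & x = \sum_i c i *: p i]].

(* Interior of A for the topology induced on its affine hull. *)
Definition relative_interior A : set 'rV[R]_n :=
  [set x | A x /\ \forall z \near x, affine_hull A z -> A z].

Definition affinely_independent m (p : 'I_m -> 'rV[R]_n) : Prop :=
  forall c : 'I_m -> R,
    \sum_i c i = 0 -> \sum_i c i *: p i = 0 -> forall i, c i = 0.

End Geometry.

Section Circuits.
Context (R : realType) {n : nat}.

Definition lattice_point (a : 'X_{1..n}) : 'rV[R]_n := \row_l (a l)%:R.

Definition even_exponent (a : 'X_{1..n}) : Prop := forall l, ~~ odd (a l).

Definition newton_polytope (f : {mpoly R[n]}) : set 'rV[R]_n :=
  convex_hull [set lattice_point a | a in [set` msupp f]].

Definition conv_points m (beta : 'I_m -> 'X_{1..n}) : set 'rV[R]_n :=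
  convex_hull (range (lattice_point \o beta)).

(* Affine independence forces m <= n. *)
Definition even_lattice_simplex m (beta : 'I_m.+1 -> 'X_{1..n}) : Prop :=
  affinely_independent (lattice_point \o beta)
  /\ forall j, even_exponent (beta j).

Definition circuit_on m (beta : 'I_m.+1 -> 'X_{1..n}) (y : 'X_{1..n}) :
    set {mpoly R[n]} :=
  [set g | exists (b : 'I_m.+1 -> R) (c : R),
    [/\ forall j, 0 < b j, c != 0
      & g = \sum_j b j *: 'X_[beta j] + c *: 'X_[y]]].

Definition monomial_square : set {mpoly R[n]} :=
  [set g | exists (b : R) (beta : 'X_{1..n}),
    [/\ 0 < b, even_exponent beta & g = b *: 'X_[beta]]].

Definition circuit_polynomial (g : {mpoly R[n]}) : Prop :=
  monomial_square g
  \/ exists m (beta : 'I_m.+1 -> 'X_{1..n}) (y : 'X_{1..n}),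
       [/\ even_lattice_simplex beta,
           relative_interior (conv_points beta) (lattice_point y)
         & circuit_on beta y g].

Definition nonnegative (f : {mpoly R[n]}) : Prop :=
  forall x : 'I_n -> R, 0 <= f.@[x].

(* msize is the total degree plus one (and 0 for the zero polynomial). *)
Definition degree_le (f : {mpoly R[n]}) (e : nat) : Prop := (msize f <= e.+1)%N.

Definition SONC (d : nat) (f : {mpoly R[n]}) : Prop :=
  degree_le f (2 * d)
  /\ exists N (mu : 'I_N -> R) (g : 'I_N -> {mpoly R[n]}),
       [/\ forall i, 0 <= mu i,
           forall i, [/\ circuit_polynomial (g i), nonnegative (g i)
                       & degree_le (g i) (2 * d)]
         & f = \sum_i mu i *: g i].

End Circuits.

(* [set T] unfolds to a function type, which would make R implicit. *)
Arguments conv_points R {n m} beta _.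

(* Main.v *)
Require Import Defs.
From HB Require Import structures.
From mathcomp Require Import all_boot all_order all_algebra.
From mathcomp Require Import boolp classical_sets reals topology.
From mathcomp Require Import normedtype sequences derive exp.
From mathcomp Require Import ring lra.
From mathcomp Require Import mpoly.

Set Implicit Arguments.
Unset Strict Implicit.
Unset Printing Implicit Defensive.

Import Order.TTheory GRing.Theory Num.Theory.
Import numFieldTopology.Exports numFieldNormedType.Exports.

Local Open Scope classical_set_scope.
Local Open Scope ring_scope.

(** Write c_i = |a_i| and let lam_i be the barycentric coordinates of y(i) in
the simplex, with alpha(0) = 0; they are all positive because y(i) is
interior.  At a point whose signs are those of v, every interior term is
negative, and since the alpha(j) are affinely independent the logarithms of
the absolute values of the coordinates can be chosen so that the vertex
monomials are exp(u_j - u_0) for arbitrary reals u_0, ..., u_n.  Thus f >= 0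
gives N(u) <= D(u) for all u, where

  N(u) = sum_i c_i exp(sum_j lam_ij u_j),   D(u) = sum_j b_j exp(u_j).

The quotient N / D does not change when a constant is added to all u_j, and it
tends to 0 at infinity modulo this translation, because every lam_ij is
positive: it attains its maximum at some u.  At such a point the partial
derivatives give, for every vertex j,

  sum_i c_i lam_ij exp(sum_l lam_il u_l) = (N / D) b_j exp(u_j)
                                        <= b_j exp(u_j).

So with b_ij = c_i lam_ij exp(sum_l lam_il u_l - u_j) one has
sum_i b_ij <= b_j, and f is the sum of the polynomials
sum_j b_ij x^alpha(j) + a_i x^y(i) and of the nonnegative multiples
(b_j - sum_i b_ij) x^alpha(j) of monomial squares.  The former are circuit
polynomials, and they are nonnegative by the weighted inequality of arithmetic
and geometric means, whose equality case is at u.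

The maximum is found in [expsum_ratio_max], the inequality at the maximum in
[expsum_stationary], the passage from f to N and D in [expsum_int_le_vert],
and the nonnegativity of the circuits rests on [weighted_amgm]. *)

(** * Convexity of the exponential and finite sums *)

(** The tangent line of exp at the weighted mean lies below exp; averaging it
gives the value at the mean. *)
Lemma expR_jensen (R : realType) m (p z : 'I_m -> R) :
  (forall j, 0 <= p j) -> \sum_j p j = 1 ->
  expR (\sum_j p j * z j) <= \sum_j p j * expR (z j).
Proof.
move=> p_ge0 p_sum1; set s := \sum_j p j * z j.
have tangent j : p j * (expR s * (1 + (z j - s))) <= p j * expR (z j).
  rewrite ler_wpM2l // -{2}(subrKC s (z j)) expRD ler_wpM2l ?expR_ge0 //.
  exact: expR_ge1Dx.
apply: le_trans (ler_sum _ (fun j _ => tangent j)).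
have -> : \sum_j p j * (expR s * (1 + (z j - s)))
          = expR s * ((1 - s) * (\sum_j p j) + s).
  rewrite /s mulr_sumr -big_split mulr_sumr /=; apply: eq_bigr => j _; ring.
by rewrite p_sum1 mulr1 subrK mulr1.
Qed.

Lemma finite_pos_lower_bound (R : realType) (T : finType) (F : T -> R) :
  (forall t, 0 < F t) -> exists2 e, 0 < e & forall t, e <= F t.
Proof.
move=> F_gt0; exists (\big[Order.min/1]_t F t).
  by apply: lt_bigmin => // t _; exact: F_gt0.
by move=> t; exact: bigmin_le_cond.
Qed.

Lemma sumr_gt0 (R : realType) (T : finType) (F : T -> R) (t : T) :
  (forall t, 0 < F t) -> 0 < \sum_t F t.
Proof.
move=> F_gt0; rewrite (bigD1 t) //= ltr_wpDr //.
by apply: sumr_ge0 => s _; exact: ltW.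
Qed.

Lemma cvg_sumr (R : realType) (T : Type) (F : set_system T) {FF : Filter F}
    m (h : 'I_m -> T -> R) (l : 'I_m -> R) :
  (forall i, h i x @[x --> F] --> l i) ->
  (\sum_i h i x) @[x --> F] --> \sum_i l i.
Proof.
by move=> hl; apply: (@cvg_big R _ +%R); [exact: add_continuous|move=> i _].
Qed.

(** * Maximising the quotient of two exponential sums *)

Section Signomial.
Context (R : realType) (n k : nat).
Variables (c : 'I_k -> R) (b : 'I_n.+1 -> R) (lam : 'I_k -> 'I_n.+1 -> R).

(** The sum of the interior terms of a polynomial, up to sign, in logarithmic
coordinates u_j attached to the vertices of its simplex. *)
Definition expsum_int (u : 'I_n.+1 -> R) : R :=
  \sum_i c i * expR (\sum_j lam i j * u j).

Definition expsum_vert (u : 'I_n.+1 -> R) : R := \sum_j b j * expR (u j).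

Hypotheses (c_gt0 : forall i, 0 < c i) (b_gt0 : forall j, 0 < b j).
Hypotheses (lam_gt0 : forall i j, 0 < lam i j).
Hypothesis lam_sum1 : forall i, \sum_j lam i j = 1.

Lemma expsum_vert_gt0 u : 0 < expsum_vert u.
Proof.
by apply: (sumr_gt0 ord0) => j; rewrite mulr_gt0 ?expR_gt0.
Qed.

Lemma expsum_int_shift u t :
  expsum_int (fun j => u j + t) = expR t * expsum_int u.
Proof.
rewrite mulr_sumr; apply: eq_bigr => i _.
under eq_bigr do rewrite mulrDr.
by rewrite big_split /= -mulr_suml lam_sum1 mul1r expRD; ring.
Qed.

Lemma expsum_vert_shift u t :
  expsum_vert (fun j => u j + t) = expR t * expsum_vert u.
Proof.
by rewrite mulr_sumr; apply: eq_bigr => j _; rewrite expRD; ring.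
Qed.

Lemma expsum_ratio_shift u t :
  expsum_int (fun j => u j + t) / expsum_vert (fun j => u j + t)
  = expsum_int u / expsum_vert u.
Proof.
rewrite expsum_int_shift expsum_vert_shift -mulf_div divff ?mul1r //.
by rewrite gt_eqF ?expR_gt0.
Qed.

Lemma expsum_ratio_cvg (T : Type) (F : set_system T) {FF : Filter F}
    (v : T -> 'I_n.+1 -> R) (u : 'I_n.+1 -> R) :
  (forall j, v x j @[x --> F] --> u j) ->
  expsum_int (v x) / expsum_vert (v x) @[x --> F]
    --> expsum_int u / expsum_vert u.
Proof.
move=> cvg_v.
have cvg_exp (h : T -> R) l :
    h x @[x --> F] --> l -> expR (h x) @[x --> F] --> expR l.
  by move=> cvg_h; apply: cvg_comp cvg_h _; exact: continuous_expR.
apply: cvgM.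
  apply: cvg_sumr => i; apply: cvgM; first exact: cvg_cst.
  apply: cvg_exp; apply: cvg_sumr => j; apply: cvgM; first exact: cvg_cst.
  exact: cvg_v.
apply: cvgV; first by rewrite gt_eqF ?expsum_vert_gt0.
apply: cvg_sumr => j; apply: cvgM; first exact: cvg_cst.
exact: cvg_exp.
Qed.

(** If max u = 0 and u j is very negative, every term of the numerator carries
the factor exp (lam i j * u j), hence is small, while the denominator is at
least the smallest b j.  So the points normalised by max u = 0 where the
quotient is at least its value at 0 lie in a box. *)
Lemma expsum_ratio_coercive :
  (0 < k)%N ->
  exists2 L, L <= 0 & forall u j0 j, (forall j, u j <= 0) -> u j0 = 0 ->
  expsum_int (fun=> 0) / expsum_vert (fun=> 0)
    <= expsum_int u / expsum_vert u -> L <= u j.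
Proof.
move=> k_gt0.
have [del del_gt0 del_le] :=
  finite_pos_lower_bound (fun ij : 'I_k * 'I_n.+1 => lam_gt0 ij.1 ij.2).
have [be be_gt0 be_le] := finite_pos_lower_bound b_gt0.
have D0_gt0 := expsum_vert_gt0 (fun=> 0).
set D0 := expsum_vert _ in D0_gt0 *.
have K_gt0 : 0 < be / D0 by rewrite divr_gt0.
(* Solution of exp (del * L) = be / D0, the bound that the comparison of the
   dominating terms gives on exp (del * u j). *)
exists (ln (be / D0) / del).
  rewrite ler_pdivrMr // mul0r -ln1 ler_ln ?posrE // ler_pdivrMr // mul1r.
  apply: le_trans (be_le ord0) _.
  rewrite /D0 /expsum_vert big_ord_recl /= expR0 mulr1 lerDl.
  by apply: sumr_ge0 => j _; rewrite mulr1 ltW.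
move=> u j0 j u_le0 uj0 ratio_le.
set C := \sum_i c i.
have C_gt0 : 0 < C by exact: (sumr_gt0 (Ordinal k_gt0)).
have N0E : expsum_int (fun=> 0) = C.
  apply: eq_bigr => i _; rewrite big1 ?expR0 ?mulr1 // => l _; exact: mulr0.
have Nu_le : expsum_int u <= C * expR (del * u j).
  rewrite mulr_suml; apply: ler_sum => i _.
  apply: ler_wpM2l; first exact: ltW.
  rewrite ler_expR.
  rewrite (bigD1 j) //= -[leRHS]addr0 lerD //.
    by rewrite ler_wnM2r ?u_le0 ?(del_le (i, j)).
  by apply: sumr_le0 => l _; rewrite pmulr_rle0.
have Du_ge : be <= expsum_vert u.
  rewrite /expsum_vert (bigD1 j0) //= uj0 expR0 mulr1 -[leLHS]addr0 lerD //.
  by apply: sumr_ge0 => l _; rewrite mulr_ge0 ?expR_ge0 ?ltW.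
rewrite ler_pdivrMr // -ler_expR lnK ?posrE //.
have : C / D0 <= C * expR (del * u j) / be.
  rewrite -N0E; apply: le_trans ratio_le _.
  rewrite ler_pM ?invr_ge0 ?(ltW (expsum_vert_gt0 _)) //; last 1 first.
  - by rewrite lef_pV2 ?posrE ?expsum_vert_gt0.
  - apply: sumr_ge0 => i _; by rewrite mulr_ge0 ?expR_ge0 ?ltW.
  - by rewrite N0E.
rewrite -mulrA ler_pM2l // ler_pdivlMr //.
by rewrite mulrC [del * _]mulrC.
Qed.

(** Subtracting max u moves any u to the orthant u <= 0 without changing the
quotient; there only a compact box competes with the value at 0. *)
Lemma expsum_ratio_max : (0 < k)%N ->
  exists u, forall u',
    expsum_int u' / expsum_vert u' <= expsum_int u / expsum_vert u.
Proof.
move=> k_gt0; have [L L_le0 coercive] := expsum_ratio_coercive k_gt0.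
pose box : set 'rV[R]_n.+1 := [set v | forall j, `[L, 0]%classic (v ord0 j)].
have box_compact : compact box.
  apply: (@rV_compact _ _ (fun=> `[L, 0]%classic)) => _.
  exact: segment_compact.
have box0 : box 0 by move=> j /=; rewrite in_itv /= mxE L_le0 lexx.
have ratio_cont : {within box, continuous
    (fun v : 'rV[R]_n.+1 => expsum_int (v ord0) / expsum_vert (v ord0))}.
  apply: continuous_subspaceT => w.
  apply: (@expsum_ratio_cvg _ (nbhs w) _ _ _ _) => j.
  exact: coord_continuous.
have [v _ v_max] :=
  compact_EVT_max (ex_intro _ _ box0) box_compact ratio_cont.
exists (v ord0) => u'.
have [small|large] := ltP (expsum_int u' / expsum_vert u')
                          (expsum_int (fun=> 0) / expsum_vert (fun=> 0)).
  apply: le_trans (ltW small) _.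
  have := v_max _ (mem_set box0).
  have -> // : (0 : 'rV[R]_n.+1) ord0 = fun=> 0.
  by apply: funext => j; rewrite mxE.
have [j0 _ j0_max] := arg_maxP u' (erefl true : xpredT (ord0 : 'I_n.+1)).
rewrite -(expsum_ratio_shift u' (- u' j0)) in large *.
set w := fun j => u' j - u' j0.
have w_le0 j : w j <= 0 by rewrite subr_le0; exact: j0_max.
have -> : w = (\row_j w j) ord0 by apply: funext => j; rewrite mxE.
apply/v_max/mem_set => j /=; rewrite in_itv /= mxE w_le0 andbT.
by apply: (coercive w j0) => //; rewrite /w subrr.
Qed.

(** The inequality that the vanishing of the j-th partial derivative of the
quotient gives at its maximum, where the quotient is at most 1.  It comes from
comparing u with u + s e_j for small s > 0: 1 + x <= exp x bounds the growth of
the numerator from below and that of the denominator from above, and s tends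
to 0. *)
Lemma expsum_stationary :
  (forall u, expsum_int u <= expsum_vert u) ->
  exists u, forall j,
    \sum_i c i * lam i j * expR (\sum_l lam i l * u l) <= b j * expR (u j).
Proof.
move=> int_le_vert; case: (posnP k) => [k0|k_gt0].
  exists (fun=> 0) => j; rewrite big1 ?mulr_ge0 ?expR_ge0 ?ltW // => i.
  by have := ltn_ord i; rewrite {2}k0.
have [u u_max] := expsum_ratio_max k_gt0; exists u => j.
set P := \sum_i _; set B := b j * _.
have P_ge0 : 0 <= P.
  by apply: sumr_ge0 => i _; rewrite !mulr_ge0 ?expR_ge0 ?ltW.
have B_gt0 : 0 < B by rewrite mulr_gt0 ?expR_gt0.
have step s : 0 < s -> s < 1 -> P * (1 - s) <= B.
  move=> s_gt0 s_lt1; pose w l := u l + (if l == j then s else 0).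
  have Nw : expsum_int u + s * P <= expsum_int w.
    rewrite mulr_sumr -big_split /=; apply: ler_sum => i _.
    have -> : \sum_l lam i l * w l = \sum_l lam i l * u l + lam i j * s.
      under eq_bigr do rewrite mulrDr.
      rewrite big_split /=.
      rewrite (bigD1 j _ (F := fun l => _ * (if _ then _ else _))) //=.
      rewrite eqxx [X in _ + (_ + X)]big1 ?addr0 // => l /negPf ->.
      by rewrite mulr0.
    rewrite expRD; set E := expR _.
    have -> : c i * E + s * (c i * lam i j * E) = c i * (E * (1 + lam i j * s)).
      by ring.
    by rewrite ler_wpM2l ?(ltW (c_gt0 i)) // ler_wpM2l ?expR_ge0 // expR_ge1Dx.
  have Dw : expsum_vert w = expsum_vert u + B * (expR s - 1).
    rewrite /expsum_vert (bigD1 j) //= [in RHS](bigD1 j) //= {1}/w eqxx expRD.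
    rewrite (eq_bigr (fun l => b l * expR (u l))).
      by rewrite /B; ring.
    by move=> l /negPf nlj; rewrite /w nlj addr0.
  have Du_gt0 := expsum_vert_gt0 u; have Dw_gt0 := expsum_vert_gt0 w.
  have := u_max w; rewrite ler_pdivrMr // mulrAC ler_pdivlMr // Dw => NwDu.
  (* The form in which exp s - 1 <= s / (1 - s) is used. *)
  have es1 : (expR s - 1) * (1 - s) <= s.
    have := expR_ge1Dx (- s); rewrite expRN => h.
    have := ler_wpM2l (expR_ge0 s) h; rewrite divff ?gt_eqF ?expR_gt0 //.
    by move=> h'; nra.
  have es0 : 0 <= expR s - 1.
    by have := expR_ge1Dx s; lra.
  have h1 : s * P * expsum_vert u <= expsum_int u * (B * (expR s - 1)).
    have := ler_wpM2r (ltW Du_gt0) Nw; move: NwDu.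
    by rewrite mulrDr mulrDl; set X := expsum_int u * _; lra.
  have h2 : s * P <= B * (expR s - 1).
    rewrite -(ler_pM2r Du_gt0); apply: le_trans h1 _.
    rewrite [leRHS]mulrC; apply: ler_wpM2r; last exact: int_le_vert.
    by rewrite mulr_ge0 // ltW.
  have h3 : s * (P * (1 - s)) <= s * B.
    rewrite mulrA; apply: le_trans (ler_wpM2r _ h2) _.
      by rewrite subr_ge0 ltW.
    rewrite -mulrA [s * B]mulrC; apply: ler_wpM2l => //; exact: ltW.
  by rewrite -(ler_pM2l s_gt0).
rewrite leNgt; apply/negP => B_lt_P.
have P_gt0 : 0 < P by exact: lt_trans B_gt0 _.
(* If B < P, this step s makes P * (1 - s) the mean of P and B. *)
have := step ((P - B) / (P *+ 2)).
rewrite divr_gt0 ?subr_gt0 // ?pmulrn_lgt0 // => /(_ erefl).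
rewrite ltr_pdivrMr ?pmulrn_lgt0 // mul1r mulr2n.
have -> : P * (1 - (P - B) / (P + P)) = (P + B) / 2.
  by field; rewrite ?gt_eqF ?addr_gt0.
have s_lt1 : P - B < P + P by lra.
by move=> /(_ s_lt1); lra.
Qed.

End Signomial.

(** * Barycentric coordinates *)

Section Barycentric.
Context (R : realType) (n m : nat).
Implicit Types (p : 'I_m -> 'rV[R]_n) (q : 'I_m -> R) (x : 'rV[R]_n).

Lemma convex_hull_rangeP p x : convex_hull (range p) x ->
  exists q, [/\ forall j, 0 <= q j, \sum_j q j = 1 & x = \sum_j q j *: p j].
Proof.
case=> N [pt [e [pt_range e_ge0 e_sum1 ->]]].
have /choice[s ptE] i : exists j, pt i = p j.
  by have [j _ <-] := pt_range i; exists j.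
exists (fun j => \sum_(i | s i == j) e i); split=> [j||].
- by apply: sumr_ge0.
- by rewrite -e_sum1 (partition_big s xpredT).
rewrite (partition_big s xpredT) //=; apply: eq_bigr => j _.
by rewrite scaler_suml; apply: eq_bigr => i /eqP <-; rewrite ptE.
Qed.

Lemma affinely_independent_coord p q q' : affinely_independent p ->
  \sum_j q j = \sum_j q' j -> \sum_j q j *: p j = \sum_j q' j *: p j ->
  q =1 q'.
Proof.
move=> p_free eq_sum eq_comb j; apply/eqP; rewrite -subr_eq0; apply/eqP.
apply: (p_free (fun j => q j - q' j)); first by rewrite sumrB eq_sum subrr.
by under eq_bigr do rewrite scalerBl; rewrite sumrB eq_comb subrr.
Qed.

(** An interior point can be pushed slightly away from the vertex p j without
leaving the simplex.  This multiplies its coordinates by 1 + h and then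
subtracts h from the j-th, which must stay nonnegative. *)
Lemma interior_barycentric_gt0 p x : affinely_independent p ->
  interior (convex_hull (range p)) x ->
  exists q, [/\ forall j, 0 < q j, \sum_j q j = 1 & x = \sum_j q j *: p j].
Proof.
move=> p_free x_int.
have [q [q_ge0 q_sum1 xE]] := convex_hull_rangeP (interior_subset x_int).
exists q; split=> // j.
have ray_cvg : e *: (x - p j) + x @[e --> (0 : R)] --> 0 *: (x - p j) + x.
  by apply: cvgD; [apply: cvgZr_tmp; exact: cvg_id|exact: cvg_cst].
rewrite scale0r add0r in ray_cvg.
have /nbhs_ballP[e /= e_gt0 ball_sub] := ray_cvg _ x_int.
have [h h_gt0 h_lt_e] : exists2 h : R, 0 < h & h < e by exists (e / 2); lra.
have [|q' [q'_ge0 q'_sum1 x'E]] := @convex_hull_rangeP p (h *: (x - p j) + x).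
  apply: ball_sub; by rewrite /ball /= sub0r normrN gtr0_norm.
have sum_delta (V : lmodType R) (z : 'I_m -> V) :
    \sum_l (l == j)%:R *: z l = z j.
  rewrite (bigD1 j) //= eqxx scale1r big1 ?addr0 // => l /negPf ->.
  by rewrite scale0r.
pose r l := (1 + h) * q l - h * (l == j)%:R.
have r_sum : \sum_l r l = \sum_l q' l.
  rewrite sumrB -!mulr_sumr q_sum1 q'_sum1.
  have := sum_delta R^o (fun=> 1); rewrite /GRing.scale /=.
  by under eq_bigr do rewrite mulr1; move=> ->; ring.
have r_comb : \sum_l r l *: p l = \sum_l q' l *: p l.
  rewrite -x'E; under eq_bigr do rewrite scalerBl -!scalerA.
  rewrite sumrB -!scaler_sumr -xE sum_delta scalerDl scale1r scalerBr.
  by rewrite -addrA addrC.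
have := affinely_independent_coord p_free r_sum r_comb j.
rewrite /r eqxx mulr1 => rj; have := q'_ge0 j; rewrite -rj subr_ge0 => qj.
have : 0 < (1 + h) * q j by apply: lt_le_trans qj.
by rewrite pmulr_rgt0 // addr_gt0.
Qed.

End Barycentric.

(** * Monomials in logarithmic coordinates *)

Section Monomials.
Context (R : realType) (n : nat).
Implicit Types (x w : 'I_n -> R) (a : 'X_{1..n}).

Definition exponent_pairing w a : R := \sum_l (a l)%:R * w l.

Lemma exponent_pairing_comb m (beta : 'I_m -> 'X_{1..n}) y (q : 'I_m -> R) w :
  lattice_point R y = \sum_j q j *: lattice_point R (beta j) ->
  exponent_pairing w y = \sum_j q j * exponent_pairing w (beta j).
Proof.
move=> yE; rewrite /exponent_pairing.
under [RHS]eq_bigr do rewrite mulr_sumr.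
rewrite exchange_big /=; apply: eq_bigr => l _.
under eq_bigr do rewrite mulrA.
rewrite -mulr_suml; congr (_ * _).
have /rowP/(_ l) := yE; rewrite mxE summxE => ->.
by apply: eq_bigr => j _; rewrite !mxE.
Qed.

Lemma mdeg_pairing a : (mdeg a)%:R = exponent_pairing (fun=> 1) a.
Proof.
by rewrite mdegE natr_sum; apply: eq_bigr => l _; rewrite mulr1.
Qed.

Lemma even_monomial_ge0 a x :
  even_exponent a -> 0 <= ('X_[a] : {mpoly R[n]}).@[x].
Proof.
move=> a_even; rewrite mevalX; apply: prodr_ge0 => l _.
exact: exprn_even_ge0.
Qed.

(** Coordinates of x may vanish where the exponent does: there 0 ^ 0 = 1
agrees with exp 0, whatever the value of the logarithm at 0. *)
Lemma norm_monomial a x : (forall l, x l = 0 -> a l = 0%N) ->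
  `|('X_[a] : {mpoly R[n]}).@[x]|
  = expR (exponent_pairing (fun l => ln `|x l|) a).
Proof.
move=> supp_a; rewrite mevalX normr_prod expR_sum; apply: eq_bigr => l _.
rewrite normrX expRM_natl; have [xl0|xl_neq0] := eqVneq (x l) 0.
  by rewrite supp_a // !expr0.
by rewrite lnK // posrE normr_gt0.
Qed.

(** The coefficients are those for which equality holds where the monomials
x^beta(j) take the values exp (u j).  In logarithmic coordinates this is
Jensen's inequality for exp.  If x^y vanishes there is nothing to prove;
otherwise the exponents y l, hence the nonnegative terms q j * beta j l that
sum to it, are 0 wherever x l is, and the logarithmic form is still valid. *)
Lemma weighted_amgm m (beta : 'I_m -> 'X_{1..n}) y (q u : 'I_m -> R) x :
  (forall j, even_exponent (beta j)) -> (forall j, 0 < q j) ->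
  \sum_j q j = 1 ->
  lattice_point R y = \sum_j q j *: lattice_point R (beta j) ->
  `|('X_[y] : {mpoly R[n]}).@[x]|
  <= \sum_j q j * expR (\sum_l q l * u l - u j)
            * ('X_[beta j] : {mpoly R[n]}).@[x].
Proof.
move=> beta_even q_gt0 q_sum1 yE.
have rhs_ge0 : 0 <= \sum_j q j * expR (\sum_l q l * u l - u j)
            * ('X_[beta j] : {mpoly R[n]}).@[x].
  apply: sumr_ge0 => j _; rewrite !mulr_ge0 ?expR_ge0 ?(ltW (q_gt0 j)) //.
  exact: even_monomial_ge0.
have [xy0|] := eqVneq (('X_[y] : {mpoly R[n]}).@[x]) 0.
  by rewrite xy0 normr0.
rewrite {1}mevalX => /prodf_neq0 xl_neq0.
have supp_y l : x l = 0 -> y l = 0%N.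
  move=> xl0; have := xl_neq0 l isT; rewrite xl0 expr0n.
  by case: (y l) => //= k; rewrite eqxx.
have supp_beta j l : x l = 0 -> beta j l = 0%N.
  move=> /supp_y yl0; have /rowP/(_ l) := yE.
  rewrite mxE yl0 summxE => /esym/psumr_eq0P coord_eq0.
  have coord_ge0 i : 0 <= (q i *: lattice_point R (beta i)) ord0 l.
    by rewrite !mxE mulr_ge0 // ltW.
  have := coord_eq0 (fun i _ => coord_ge0 i) j isT.
  by rewrite !mxE => /eqP; rewrite mulf_eq0 gt_eqF //= pnatr_eq0 => /eqP.
rewrite norm_monomial // (exponent_pairing_comb _ yE).
set z := exponent_pairing _.
have -> : \sum_j q j * z (beta j)
          = \sum_l q l * u l + \sum_j q j * (z (beta j) - u j).
  by rewrite -big_split /=; apply: eq_bigr => j _; ring.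
rewrite expRD; set s := \sum_l q l * u l.
have jensen := expR_jensen (fun j => z (beta j) - u j)
  (fun j => ltW (q_gt0 j)) q_sum1.
apply: le_trans (ler_wpM2l (expR_ge0 _) jensen) _.
rewrite mulr_sumr; apply: ler_sum => j _.
rewrite -[('X_[beta j]).@[x]]ger0_norm ?even_monomial_ge0 //.
rewrite norm_monomial; last exact: supp_beta.
by rewrite expRB expRD expRN -/z le_eqVlt; apply/orP; left; apply/eqP; ring.
Qed.

(** The degree is a linear functional of the exponent, so its bound on the
support extends to the Newton polytope. *)
Lemma degree_le_convex_hull (f : {mpoly R[n]}) a e :
  degree_le f e -> newton_polytope f (lattice_point R a) -> (mdeg a <= e)%N.
Proof.
move=> f_deg [N [p [q [p_supp q_ge0 q_sum1 aE]]]].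
have /choice[s pE] i : exists t, t \in msupp f /\ lattice_point R t = p i.
  by have [t ? ?] := p_supp i; exists t.
rewrite -(ler_nat R) mdeg_pairing.
rewrite (exponent_pairing_comb (beta := s) (q := q)); last first.
  by rewrite aE; apply: eq_bigr => i _; have [_ ->] := pE i.
have -> : e%:R = \sum_i q i * e%:R :> R by rewrite -mulr_suml q_sum1 mul1r.
apply: ler_sum => i _.
rewrite ler_wpM2l // -mdeg_pairing ler_nat -ltnS.
by apply: leq_trans f_deg; apply: msize_mdeg_lt; have [] := pE i.
Qed.

Lemma degree_leX a e c :
  (mdeg a <= e)%N -> degree_le (c *: 'X_[a] : {mpoly R[n]}) e.
Proof. by move=> a_deg; apply: leq_trans (msizeZ_le _ _) _; rewrite msizeX. Qed.

Lemma degree_leD (f g : {mpoly R[n]}) e :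
  degree_le f e -> degree_le g e -> degree_le (f + g) e.
Proof.
move=> ? ?; apply: leq_trans (msizeD_le _ _) _.
by rewrite geq_max; apply/andP.
Qed.

Lemma degree_le_sum m (g : 'I_m -> {mpoly R[n]}) e :
  (forall i, degree_le (g i) e) -> degree_le (\sum_i g i) e.
Proof.
move=> g_deg; apply: leq_trans (msize_sum _ _ _) _.
by apply/bigmax_leqP => i _; exact: g_deg.
Qed.

(** As alpha(0) = 0, affine independence makes the other n exponents a basis,
on which a linear form can take arbitrary values. *)
Lemma pairing_surjective (alpha : 'I_n.+1 -> 'X_{1..n}) (u : 'I_n.+1 -> R) :
  alpha ord0 = 0%MM -> affinely_independent (lattice_point R \o alpha) ->
  exists w, forall j, exponent_pairing w (alpha j) = u j - u ord0.
Proof.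
move=> alpha0 alpha_free.
pose M := \matrix_(j < n) lattice_point R (alpha (lift ord0 j)).
have M_unit : M \in unitmx.
  rewrite -row_free_unit; apply: inj_row_free => v vM0.
  (* A linear relation v becomes an affine one with the coefficient of the
     vertex 0 making the sum vanish. *)
  pose c (j : 'I_n.+1) :=
    if unlift ord0 j is Some i then v ord0 i else - \sum_i v ord0 i.
  have cl i : c (lift ord0 i) = v ord0 i by rewrite /c liftK.
  have c0 : c ord0 = - \sum_i v ord0 i by rewrite /c unlift_none.
  apply/rowP => i; rewrite mxE -cl; apply: (alpha_free c).
    by rewrite big_ord_recl c0 (eq_bigr _ (fun i _ => cl i)) addNr.
  rewrite big_ord_recl /= alpha0.
  have -> : lattice_point R (0%MM : 'X_{1..n}) = 0.
    by apply/rowP => l; rewrite !mxE mnm0E.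
  rewrite scaler0 add0r -[RHS]vM0 mulmx_sum_row.
  by apply: eq_bigr => l _; rewrite cl rowK.
pose t : 'cV[R]_n := invmx M *m \col_j (u (lift ord0 j) - u ord0).
exists (fun l => t l ord0) => j.
case: (unliftP ord0 j) => [i ->|->]; last first.
  by rewrite subrr alpha0 /exponent_pairing big1 // => l _; rewrite mnm0E mul0r.
have := mulKVmx M_unit (\col_j (u (lift ord0 j) - u ord0)).
move=> /colP/(_ i); rewrite !mxE -/t => <-.
by apply: eq_bigr => l _; rewrite !mxE.
Qed.

End Monomials.

(** * Splitting a polynomial over a simplex into circuits *)

Section SimplexNewtonPolytope.
Context (R : realType) (n k : nat).
Variables (b : 'I_n.+1 -> R) (alpha : 'I_n.+1 -> 'X_{1..n}).
Variables (a : 'I_k -> R) (y : 'I_k -> 'X_{1..n}) (lam : 'I_k -> 'I_n.+1 -> R).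

Definition simplex_poly : {mpoly R[n]} :=
  \sum_j b j *: 'X_[alpha j] + \sum_i a i *: 'X_[y i].

Hypotheses (alpha0 : alpha ord0 = 0%MM)
  (alpha_free : affinely_independent (lattice_point R \o alpha))
  (alpha_even : forall j, even_exponent (alpha j))
  (lam_sum1 : forall i, \sum_j lam i j = 1)
  (y_comb : forall i, lattice_point R (y i)
                      = \sum_j lam i j *: lattice_point R (alpha j)).

(** Evaluating at a point of the orthant of v makes all interior terms
negative; the vertex monomials are even, so they do not see the signs. *)
Lemma expsum_int_le_vert (v : 'I_n -> R) : nonnegative simplex_poly ->
  (forall l, v l != 0) -> (forall i, a i * \prod_l v l ^+ y i l < 0) ->
  forall u, expsum_int (fun i => `|a i|) lam u <= expsum_vert b u.
Proof.
move=> f_ge0 v_neq0 av_lt0 u.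
have [w wE] := pairing_surjective u alpha0 alpha_free.
pose x l := Num.sg (v l) * expR (w l).
have normx l : `|x l| = expR (w l).
  by rewrite normrM normr_sg v_neq0 mul1r gtr0_norm ?expR_gt0.
have monx e : `|('X_[e] : {mpoly R[n]}).@[x]| = expR (exponent_pairing w e).
  rewrite norm_monomial => [|l xl0].
    by congr expR; apply: eq_bigr => l _; rewrite normx expRK.
  by have := expR_gt0 (w l); rewrite -normx xl0 normr0 ltxx.
have vert j : ('X_[alpha j] : {mpoly R[n]}).@[x] = expR (u j - u ord0).
  by rewrite -wE -monx ger0_norm // even_monomial_ge0.
have int i : a i * ('X_[y i] : {mpoly R[n]}).@[x]
             = - (`|a i| * expR (\sum_j lam i j * (u j - u ord0))).
  have <- : exponent_pairing w (y i) = \sum_j lam i j * (u j - u ord0).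
    rewrite (exponent_pairing_comb w (y_comb i)).
    by apply: eq_bigr => j _; rewrite wE.
  rewrite -monx -normrM ler0_norm ?opprK // ltW //.
  set V := \prod_l v l ^+ y i l; have aV_lt0 : a i * V < 0 := av_lt0 i.
  (* v l * x l = |v l| * expR (w l), so x^y has the sign of v^y. *)
  have VX_gt0 : 0 < V * ('X_[y i] : {mpoly R[n]}).@[x].
    rewrite mevalX -big_split /= prodr_gt0 // => l _.
    rewrite -exprMn exprn_gt0 // mulrA [v l * _]mulrC -normrEsg.
    by rewrite mulr_gt0 ?normr_gt0 ?expR_gt0.
  rewrite ltNge; apply/negP => aX_ge0.
  have := mulr_ge0_le0 aX_ge0 (ltW aV_lt0).
  have a2_gt0 : 0 < a i ^+ 2.
    rewrite exprn_even_gt0 //=.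
    by apply: contraTneq aV_lt0 => ->; rewrite mul0r ltxx.
  have : 0 < a i ^+ 2 * (V * ('X_[y i] : {mpoly R[n]}).@[x]).
    by rewrite mulr_gt0.
  by set X := ('X_[y i]).@[x]; lra.
have := f_ge0 x; rewrite mevalD !raddf_sum /=.
under eq_bigr do rewrite mevalZ vert.
under [X in _ + X]eq_bigr do rewrite mevalZ int.
rewrite sumrN subr_ge0.
rewrite -/(expsum_vert b (fun j => u j - u ord0)).
rewrite -/(expsum_int (fun i => `|a i|) lam (fun j => u j - u ord0)).
by rewrite expsum_int_shift // expsum_vert_shift ler_pM2l ?expR_gt0.
Qed.

(** The part of the coefficient of x^alpha(j) spent on the i-th interior term,
chosen so that equality in the weighted mean inequality holds at u. *)
Definition circuit_coef (u : 'I_n.+1 -> R) i j : R :=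
  `|a i| * lam i j * expR (\sum_l lam i l * u l - u j).

Definition circuit_summand u i : {mpoly R[n]} :=
  \sum_j circuit_coef u i j *: 'X_[alpha j] + a i *: 'X_[y i].

Hypothesis lam_gt0 : forall i j, 0 < lam i j.

Lemma circuit_summand_ge0 u i : nonnegative (circuit_summand u i).
Proof.
move=> x; rewrite mevalD raddf_sum /= mevalZ.
under eq_bigr do rewrite mevalZ.
have -> : \sum_j circuit_coef u i j * ('X_[alpha j] : {mpoly R[n]}).@[x]
  = `|a i| * \sum_j lam i j * expR (\sum_l lam i l * u l - u j)
                            * ('X_[alpha j] : {mpoly R[n]}).@[x].
  by rewrite mulr_sumr; apply: eq_bigr => j _; rewrite !mulrA.
have amgm := weighted_amgm u x alpha_even (lam_gt0 i) (lam_sum1 i) (y_comb i).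
have := ler_wpM2l (normr_ge0 (a i)) amgm; rewrite -normrM.
set X := a i * _ => norm_le; have := lerNnormlW (lexx `|X|); lra.
Qed.

Lemma simplex_poly_decomposition u :
  simplex_poly = \sum_i circuit_summand u i
    + \sum_j (b j - \sum_i circuit_coef u i j) *: 'X_[alpha j].
Proof.
rewrite big_split /= exchange_big /= addrAC -big_split /=; congr (_ + _).
apply: eq_bigr => j _.
by rewrite -scaler_suml -scalerDl addrC subrK.
Qed.

End SimplexNewtonPolytope.

(* The vertices 0, alpha(1), ..., alpha(n) are indexed by 'I_n.+1, with
   alpha ord0 = 0. *)
Theorem corollary7p5 (R : realType) (n k d : nat)
    (b : 'I_n.+1 -> R) (alpha : 'I_n.+1 -> 'X_{1..n})
    (a : 'I_k -> R) (y : 'I_k -> 'X_{1..n}) (f : {mpoly R[n]})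
    (alpha0 : alpha ord0 = 0%MM)
    (f_def : f = (b ord0)%:MP
                 + \sum_(j < n) b (lift ord0 j) *: 'X_[alpha (lift ord0 j)]
                 + \sum_(i < k) a i *: 'X_[y i])
    (f_ge0 : nonnegative f)
    (f_deg : degree_le f (2 * d))
    (b_gt0 : forall j, 0 < b j)
    (a_neq0 : forall i, a i != 0)
    (simplex_alpha : even_lattice_simplex R alpha)
    (newton_f : newton_polytope f = conv_points R alpha)
    (y_int : forall i, interior (conv_points R alpha) (lattice_point R (y i)))
    (v_ex : exists v : 'I_n -> R,
       (forall l, v l != 0)
       /\ forall i, a i * \prod_(l < n) v l ^+ y i l < 0) :
  SONC d f.
Proof.
have [alpha_free alpha_even] := simplex_alpha.
have [v [v_neq0 av_lt0]] := v_ex.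
have /choice[lam lamP] i := interior_barycentric_gt0 alpha_free (y_int i).
have lam_gt0 i j : 0 < lam i j by have [? _ _] := lamP i.
have lam_sum1 i : \sum_j lam i j = 1 by have [_ ? _] := lamP i.
have y_comb i : lattice_point R (y i)
                = \sum_j lam i j *: lattice_point R (alpha j).
  by have [_ _ ?] := lamP i.
have fE : f = simplex_poly b alpha a y.
  by rewrite f_def /simplex_poly big_ord_recl alpha0 mpolyX0 alg_mpolyC.
have a_gt0 i : 0 < `|a i| by rewrite normr_gt0.
have int_le_vert :
    forall u, expsum_int (fun i => `|a i|) lam u <= expsum_vert b u.
  apply: (expsum_int_le_vert alpha0 alpha_free _ _ y_comb) v_neq0 av_lt0 => //.
  by rewrite -fE.
have [u stationary] :=
  expsum_stationary a_gt0 b_gt0 lam_gt0 lam_sum1 int_le_vert.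
(* The vertices and the y(i) lie in the Newton polytope of f, so their degrees
   are at most that of f. *)
have vert_deg j : (mdeg (alpha j) <= 2 * d)%N.
  apply: (degree_le_convex_hull f_deg); rewrite newton_f.
  exists 1%N, (fun=> lattice_point R (alpha j)), (fun=> 1).
  by split=> [i|i||]; rewrite ?big_ord1 ?scale1r //; exists j.
have int_deg i : (mdeg (y i) <= 2 * d)%N.
  apply: (degree_le_convex_hull f_deg); rewrite newton_f.
  exact: interior_subset (y_int i).
have coef_gt0 i j : 0 < circuit_coef a lam u i j.
  by rewrite !mulr_gt0 ?expR_gt0.
split=> //; exists (k + n.+1)%N.
exists (fun s => if split s is inr j
  then b j - \sum_i circuit_coef a lam u i j else 1).
exists (fun s => match split s with
  | inl i => circuit_summand alpha a y lam u i
  | inr j => 1 *: 'X_[alpha j] end).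
split=> [s|s|].
- case: (split s) => // j; rewrite subr_ge0 -(ler_pM2r (expR_gt0 (u j))).
  apply: le_trans (stationary j); rewrite mulr_suml.
  apply: ler_sum => i _.
  by rewrite /circuit_coef -[leLHS]mulrA -expRD subrK.
- case: (split s) => [i|j]; split.
  + right; exists n, alpha, (y i); split=> //.
      split; first exact: interior_subset (y_int i).
      by apply: filterS (y_int i) => z ? _.
    by exists (circuit_coef a lam u i), (a i).
  + exact: circuit_summand_ge0.
  + apply: degree_leD; last exact: degree_leX.
    by apply: degree_le_sum => j; exact: degree_leX.
  + by left; exists 1, (alpha j).
  + by move=> x; rewrite scale1r; exact: even_monomial_ge0.
  + exact: degree_leX.
rewrite fE (simplex_poly_decomposition b alpha a y lam u) big_split_ord /=.
congr (_ + _); apply: eq_bigr => i _.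
  by rewrite (unsplitK (inl _ i)) scale1r.
by rewrite (unsplitK (inr _ i)) scale1r.
Qed.
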